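(* Let $k \ge 8$ be an integer and let $p$ be the smallest prime strictly larger than $k$. Then there exist a constant $c>0$ and an integer $n_0$, both depending only on $k$, such that for every integer $n\ge n_0$ there is a metric space $(X,d_X)$ with $|X|=n$ for which every $(\alpha,k)$-tree cover of $(X,d_X)$ satisfies $$\alpha \;\ge\; c\, n^{1/[k(p-1)]}.$$
   Context: For an edge-weighted tree $T$ (nonnegative real edge weights) with vertex set $X$, $d_T$ denotes its shortest-path metric on $X$. An $(\alpha,k)$-tree cover (a tree cover of size $k$ and distortion $\alpha$) of a finite metric space $(X,d_X)$ is a collection $T_1,\ldots,T_k$ of $k$ edge-weighted trees, each with vertex set exactly $X$, such that (i) every tree is dominating: $d_{T_i}(x,y)\ge d_X(x,y)$ for all $x,y\in X$ and all $i\in\{1,\dots,k\}$; and (ii) $\min_{1\le i\le k} d_{T_i}(x,y)\le \alpha\, d_X(x,y)$ for all $x,y\in X$. *)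

(* Defs.v *)
From HB Require Import structures.
From mathcomp Require Export all_boot all_order all_algebra.
From mathcomp Require Export all_classical all_reals all_analysis.

Set Implicit Arguments.
Unset Strict Implicit.
Unset Printing Implicit Defensive.

Import Order.TTheory GRing.Theory Num.Theory.

Local Open Scope classical_set_scope.
Local Open Scope ring_scope.

(* The vertex set is the whole type X. The values of twt on non-adjacent
   pairs are never used. *)
Record wtree (R : realType) (X : choiceType) := WTree {
  tadj : rel X;
  twt : X -> X -> R;
  tadj_sym : symmetric tadj;
  tadj_irr : irreflexive tadj;
  tadj_connected : forall x y : X, exists2 s : seq X, path tadj x s & last x s = y;
  tadj_acyclic : forall c : seq X, (2 < size c)%N -> ~ ucycle tadj c;
  twt_sym : forall x y : X, tadj x y -> twt x y = twt y x;
  twt_ge0 : forall x y : X, tadj x y -> 0 <= twt x y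
}.

(* The total weight of the walk x :: s. *)
Definition walk_weight (R : realType) (X : choiceType) (T : wtree R X)
    (x : X) (s : seq X) : R :=
  \sum_(r <- pairmap (twt T) x s) r.

Definition tree_dist (R : realType) (X : choiceType) (T : wtree R X)
    (x y : X) : R :=
  inf [set walk_weight T x s | s in [set s | path (tadj T) x s /\ last x s = y]].

(* In the second clause, the minimum of the k tree distances is at most
   alpha * mdist x y iff one of them is. *)
Definition is_tree_cover (R : realType) (X : metricType R) (alpha : R) (k : nat)
    (T : 'I_k -> wtree R X) : Prop :=
  (forall (i : 'I_k) (x y : X), mdist x y <= tree_dist (T i) x y) /\
  (forall x y : X, exists i : 'I_k, tree_dist (T i) x y <= alpha * mdist x y).

(* Main.v *)
From HB Require Import structures.
Require Import Defs.
From mathcomp Require Import all_boot all_order all_algebra all_fingroup zify ring lra.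
From mathcomp Require Import all_classical all_reals all_analysis.

Set Implicit Arguments.
Unset Strict Implicit.
Unset Printing Implicit Defensive.

Import Order.TTheory GRing.Theory Num.Theory.

Local Open Scope classical_set_scope.
Local Open Scope card_scope.
Local Open Scope ring_scope.

(* The hard space is the torus (Z/N)^D with D = k^2 <= k(p-1) and the Chebyshev metric.
   Suppose that a cover has distortion less than a small multiple of N. Since trees have
   no cycles, summing the short displacements along the edges of the i-th tree gives a
   map l_i from the torus to Z^D such that l_i(y) - l_i(x) is the true displacement
   whenever that tree is good for (x, y). So for each x and each o in the box [0,L]^D
   some i satisfies l_i(x+o) = l_i(x) + o; let i(x) be an index that serves at least a
   fraction 1/k of the box, and consider the self-map x |-> x - l_{i(x)}(x). By a
   degree computation it is nondegenerate on some simplex x, x+e_{s0}, x+e_{s0}+e_{s1},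
   ..., with D+1 vertices. Nondegeneracy makes the D+1 served sets disjoint in
   {1..k} x [0,L+1]^D, which is impossible for large L because D+1 > k * k. *)

(** * The degree of a self-map of a torus, computed on Kuhn simplices *)

Section KuhnCycle.
Variables (V : finZmodType) (d : nat) (e : 'I_d.+1 -> V).
Implicit Types (x : V) (s : 'S_d.+1).

(** The vertices of a Kuhn simplex: a path leaves [x] and adds the directions [e (s 0)], [e (s 1)],
    ... in turn. The index is a [nat] because the path has [d.+2] vertices. *)
Definition kvertex s x (j : nat) : V := x + \sum_(i < d.+1 | (i < j)%N) e (s i).

Lemma kvertexS s x (j : 'I_d.+1) : kvertex s x j.+1 = kvertex s x j + e (s j).
Proof.
rewrite /kvertex (bigD1 j) //= [e _ + _]addrC addrA; congr (_ + _ + _).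
by apply: eq_bigl => i; rewrite ltnS ltn_neqAle andbC.
Qed.

(** The first [j] positions contain both or neither of [a] and [b] unless [j = b]. *)
Lemma kvertex_tperm s x (a b : 'I_d.+1) (j : nat) :
  b = a.+1 :> nat -> j != b -> kvertex (tperm a b * s)%g x j = kvertex s x j.
Proof.
move=> bE jb; rewrite /kvertex; congr (_ + _).
rewrite (reindex_inj (@perm_inj _ (tperm a b))) /=.
apply: eq_big => [i|i _]; last by rewrite permM tpermK.
case: tpermP => [->|->|//]; move: jb; rewrite bE; case: ltngtP => //; lia.
Qed.


Lemma kvertex_tperm_mid s x (a b : 'I_d.+1) : b = a.+1 :> nat ->
  kvertex (tperm a b * s)%g x b = kvertex s x a + e (s b).
Proof.
move=> bE; rewrite [in LHS]bE kvertexS permM tpermL kvertex_tperm ?bE //.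
by rewrite neq_ltn ltnSn.
Qed.

(* Dropping the first vertex of the path of [s] from [x] is dropping the last vertex of
   the path of [krot * s] from [x + e (s 0)]. *)
Definition krot : 'S_d.+1 := lift_perm ord_max ord0 1%g.

Lemma krotS (j : 'I_d.+1) : (j < d)%N -> krot j = j.+1 :> nat.
Proof.
move=> jd; have -> : j = lift ord_max (Ordinal jd).
  by apply: val_inj; rewrite [RHS]lift_max.
by rewrite /krot lift_perm_lift perm1 lift0 lift_max.
Qed.

Lemma kvertex_rot s x (j : nat) : (j <= d)%N ->
  kvertex (krot * s)%g (x + e (s ord0)) j = kvertex s x j.+1.
Proof.
elim: j => [|j IH] jd.
  rewrite /kvertex big1 ?addr0 // (big_pred1 ord0) // => i.
  by rewrite ltnS leqn0.
have jD : (j < d.+1)%N by apply: ltnW.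
have jD' : (j.+1 < d.+1)%N by [].
rewrite -[j.+1]/(Ordinal jD).+1 kvertexS IH 1?ltnW //.
rewrite -[j.+2]/(Ordinal jD').+1 kvertexS permM; congr (_ + e (s _)).
by apply: val_inj; rewrite /= krotS.
Qed.

(** [w x i] is the value of a 1-cochain on the edge from [x] to [x + e i]; its sums along the two
    sides of any square agree. *)
Definition closed_cochain (w : V -> 'I_d.+1 -> int) :=
  forall x i j, w x i + w (x + e i) j = w x j + w (x + e j) i.

Definition kstep (w : V -> 'I_d.+1 -> int) s x (j : 'I_d.+1) : int :=
  w (kvertex s x j) (s j).

(** Evaluation of a top-dimensional cochain on the fundamental cycle of the torus. *)
Definition kint (F : V -> 'S_d.+1 -> int) : int :=
  \sum_x \sum_(s : 'S_d.+1) (-1) ^+ s * F x s.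

(** The simplices of [s] and [tperm a b * s] have opposite signs and differ only in vertex [b]. By
    closedness, steps [a] and [b] have the same sum along both, so these sums cancel in pairs. *)
Lemma kint_swap (w : V -> 'I_d.+1 -> int) (H : V -> 'S_d.+1 -> int) (a b : 'I_d.+1) :
  closed_cochain w -> b = a.+1 :> nat ->
  (forall x s, H x (tperm a b * s)%g = H x s) ->
  kint (fun x s => H x s * kstep w s x a) = - kint (fun x s => H x s * kstep w s x b).
Proof.
move=> wC bE HE; apply/eqP; rewrite -addr_eq0 /kint -big_split /=; apply/eqP.
apply: big1 => x _; rewrite -big_split /=.
under eq_bigr => s _ do rewrite -mulrDr -mulrDr.
set S := (X in X = _); suff : S = - S by lia.
rewrite {1}/S (reindex_inj (@mulgI _ (tperm a b))) /= -sumrN; apply: eq_bigr => s _.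
have ab : a != b by rewrite -val_eqE /= bE neq_ltn ltnSn.
rewrite odd_permM odd_tperm ab signr_addb expr1 mulN1r mulNr; congr (- (_ * _)).
rewrite HE; congr (_ * _); rewrite /kstep !permM tpermL tpermR.
rewrite kvertex_tperm_mid // kvertex_tperm ?bE ?neq_ltn ?ltnSn //.
by rewrite -[in RHS]bE [in RHS]bE kvertexS.
Qed.

(** [krot] is a cycle of length [d.+1], whence the sign; the change of base point is a translation
    of [V]. *)
Lemma kint_rot (F G : V -> 'S_d.+1 -> int) :
  (forall x s, F x s = G (x + e (s ord0)) (krot * s)%g) ->
  kint F = (-1) ^+ d * kint G.
Proof.
move=> FG; rewrite /kint [in RHS]exchange_big /= (reindex_inj (@mulgI _ krot)) /=.
rewrite exchange_big /= mulr_sumr; apply: eq_bigr => s _.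
rewrite mulr_sumr [in RHS](reindex_inj (addIr (e (s ord0)))) /=.
apply: eq_bigr => x _; rewrite FG odd_permM /krot odd_lift_perm odd_perm1 /=.
rewrite addbF addbF signr_addb signr_odd !mulrA -exprMn mulN1r opprK expr1n.
by rewrite mul1r.
Qed.


Lemma kstep_tperm w s x (a b j : 'I_d.+1) : b = a.+1 :> nat -> j != a -> j != b ->
  kstep w (tperm a b * s)%g x j = kstep w s x j.
Proof.
move=> bE ja jb; rewrite /kstep kvertex_tperm // permM tpermD // eq_sym //.
Qed.

Lemma eq_kint (F G : V -> 'S_d.+1 -> int) : (forall x s, F x s = G x s) -> kint F = kint G.
Proof.
by move=> FG; apply: eq_bigr => x _; apply: eq_bigr => s _; rewrite FG.
Qed.


Section Exact.
Variables (w : 'I_d.+1 -> V -> 'I_d.+1 -> int) (m : 'I_d.+1).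
Hypothesis wC : forall j, closed_cochain (w j).

(* The missing step can be moved along the path at the cost of a sign; once it is first
   or last, [krot] exchanges the two terms of the coboundary of [g]. *)
Let skip (h : V -> 'S_d.+1 -> int) (u : 'I_d.+1 -> nat) x s : int :=
  h x s * \prod_(j | j != m) kstep (w j) s x (inord (u j)).

Let kint_skip h (u u' : 'I_d.+1 -> nat) (q a b : 'I_d.+1) :
  b = a.+1 :> nat -> q != m -> u q = a -> u' q = b ->
  (forall x s, h x (tperm a b * s)%g = h x s) ->
  (forall j, j != m -> j != q ->
     [/\ u' j = u j, u j != a, u j != b & (u j < d.+1)%N]) ->
  kint (skip h u) = - kint (skip h u').
Proof.
move=> bE qm uq u'q hE uE.
pose H x s : int := h x s *
  \prod_(j | (j != m) && (j != q)) kstep (w j) s x (inord (u j)).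
have HE x s : H x (tperm a b * s)%g = H x s.
  rewrite /H hE; congr (_ * _); apply: eq_bigr => j /andP[jm jq].
  have [_ ja jb jD] := uE j jm jq.
  by rewrite kstep_tperm // -val_eqE /= inordK.
transitivity (kint (fun x s => H x s * kstep (w q) s x a)).
  apply: eq_kint => x s; rewrite /skip (bigD1 q) //= uq inord_val.
  by rewrite mulrCA mulrC.
rewrite (kint_swap _ _ HE) //; congr (- _); apply: eq_kint => x s.
rewrite /skip (bigD1 q) //= u'q inord_val [RHS]mulrCA [RHS]mulrC; congr (_ * _ * _).
by apply: eq_bigr => j /andP[jm jq]; case: (uE j jm jq) => ->.
Qed.

Variable g : V -> int.

(** For [t <= m] and [m <= t] respectively, [before t] and [after t] send the indices other than [m]
    to the positions other than [t]. Both are the identity when [t = m]. *)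
Let before (t j : nat) : nat := j + (t <= j < m).
Let after (t j : nat) : nat := j - (m < j <= t).
Let vert (i : nat) x s : int := g (kvertex s x i).

Let before_step t : (t < m)%N ->
  kint (skip (vert m.+1) (before t)) = - kint (skip (vert m.+1) (before t.+1)).
Proof.
move=> tm; have mD := ltn_ord m.
have tD : (t < d.+1)%N by lia.
have tD' : (t.+1 < d.+1)%N by lia.
rewrite (@kint_skip _ (before t.+1) (before t) (Ordinal tD) (Ordinal tD) (Ordinal tD')).
- by rewrite opprK.
- by [].
- by rewrite neq_ltn /= tm.
- rewrite /before /=; lia.
- rewrite /before /=; lia.
- by move=> x s; rewrite /vert kvertex_tperm //= neq_ltn; lia.
- move=> j; rewrite -!val_eqE /= => jm jt; have jD := ltn_ord j.
  by rewrite /before; split; try lia.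
Qed.

Let after_step t : (m <= t)%N -> (t < d)%N ->
  kint (skip (vert m) (after t)) = - kint (skip (vert m) (after t.+1)).
Proof.
move=> tm td; have mD := ltn_ord m.
have tD : (t < d.+1)%N by lia.
have tD' : (t.+1 < d.+1)%N by lia.
rewrite (@kint_skip _ (after t.+1) (after t) (Ordinal tD') (Ordinal tD) (Ordinal tD')).
- by rewrite opprK.
- by [].
- by rewrite neq_ltn /=; lia.
- rewrite /after /=; lia.
- rewrite /after /=; lia.
- by move=> x s; rewrite /vert kvertex_tperm //= neq_ltn; lia.
- move=> j; rewrite -!val_eqE /= => jm jt; have jD := ltn_ord j.
  by rewrite /after; split; try lia.
Qed.

(** A form of Stokes' theorem without boundary. Moving the gap from [m] to the first position costs
    [(-1) ^+ m], to the last one [(-1) ^+ (d - m)], and the rotation between the two costs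
    [(-1) ^+ d]; so the two terms cancel. *)
Lemma kint_exact :
  kint (fun x s => (g (kvertex s x m.+1) - g (kvertex s x m)) *
                   \prod_(j | j != m) kstep (w j) s x j) = 0.
Proof.
have mD := ltn_ord m.
have beforeE : forall t, (t <= m)%N -> 
  kint (skip (vert m.+1) (before 0)) = (-1) ^+ t * kint (skip (vert m.+1) (before t)).
  elim=> [|t IH] tm; first by rewrite mul1r.
  by rewrite IH 1?ltnW // before_step // exprS mulrN mulN1r mulNr.
have afterE : forall t, (m + t <= d)%N -> 
  kint (skip (vert m) (after m)) = (-1) ^+ t * kint (skip (vert m) (after (m + t))).
  elim=> [|t IH] tm; first by rewrite mul1r addn0.
  rewrite IH; last lia.
  by rewrite after_step ?addnS ?exprS ?mulrN ?mulN1r ?mulNr //; lia.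
have rotE : kint (skip (vert m.+1) (before 0)) = (-1) ^+ d * kint (skip (vert m) (after d)).
  apply: kint_rot => x s; rewrite /skip /vert kvertex_rot; last lia.
  congr (_ * _); apply: eq_bigr => j; rewrite -val_eqE /= => jm.
  have jD := ltn_ord j.
  have aD : (after d j < d)%N by rewrite /after; lia.
  have aE : before 0 j = (after d j).+1 by rewrite /before /after; lia.
  rewrite /kstep kvertex_rot ?inordK ?aE //; try lia.
  rewrite permM; congr (w _ _ (s _)).
  by apply: val_inj; rewrite /= krotS !inordK //; lia.
have -> : kint (fun x s => (g (kvertex s x m.+1) - g (kvertex s x m)) *
                   \prod_(j | j != m) kstep (w j) s x j) =
    kint (skip (vert m.+1) (before m)) - kint (skip (vert m) (after m)).
  rewrite /kint -sumrB; apply: eq_bigr => x _; rewrite -sumrB; apply: eq_bigr => s _.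
  rewrite /skip /vert mulrBl mulrBr; congr (_ * (_ * _) - _ * (_ * _)).
    apply: eq_bigr => j; rewrite -val_eqE /= => jm; have jD := ltn_ord j.
    by congr (kstep _ _ _ _); apply: val_inj; rewrite /= /before inordK; lia.
  apply: eq_bigr => j; rewrite -val_eqE /= => jm; have jD := ltn_ord j.
  by congr (kstep _ _ _ _); apply: val_inj; rewrite /= /after inordK; lia.
apply/eqP; rewrite subr_eq0; apply/eqP.
apply: (@mulfI _ ((-1) ^+ m)); first by rewrite signr_eq0.
rewrite -beforeE // rotE (afterE (d - m)%N); last lia.
rewrite mulrA -exprD; have -> : (m + (d - m) = d)%N by lia.
by [].
Qed.

End Exact.

Lemma kint_cst (c : 'I_d.+1 -> 'I_d.+1 -> int) :
  kint (fun x s => \prod_j c j (s j)) = #|V|%:R * \det (\matrix_(i, j) c i j).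
Proof.
rewrite /kint sumr_const /determinant mulr_natl; congr (_ *+ _).
by apply: eq_bigr => s _; congr (_ * _); apply: eq_bigr => j _; rewrite mxE.
Qed.

(* Replacing the closed cochains by cohomologous constant ones, one at a time. *)
Lemma kint_cohomologous (c : 'I_d.+1 -> 'I_d.+1 -> int) (g : 'I_d.+1 -> V -> int)
    (w := fun j x i => c j i + (g j (x + e i) - g j x)) :
  kint (fun x s => \prod_j kstep (w j) s x j) = #|V|%:R * \det (\matrix_(i, j) c i j).
Proof.
rewrite -kint_cst.
pose h t (j : 'I_d.+1) x i : int := if (j < t)%N then c j i else w j x i.
have hC t j : closed_cochain (h t j).
  move=> x i l; rewrite /h; case: ifP => _; first by rewrite addrC.
  rewrite /w [x + e l + e i]addrAC; ring.
suff H t : (t <= d.+1)%N -> kint (fun x s => \prod_j kstep (w j) s x j) =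
    kint (fun x s => \prod_j kstep (h t j) s x j).
  rewrite (H d.+1) //; apply: eq_kint => x s; apply: eq_bigr => j _.
  by rewrite /kstep /h ltn_ord.
elim: t => [|t IH] tD.
  by apply: eq_kint => x s; apply: eq_bigr.
rewrite IH 1?ltnW //; apply/eqP; rewrite -subr_eq0; apply/eqP.
pose m := Ordinal tD.
rewrite -[RHS](kint_exact m (hC t) (g m)) /kint -sumrB; apply: eq_bigr => x _.
rewrite -sumrB; apply: eq_bigr => s _; rewrite -mulrBr; congr (_ * _).
rewrite (bigD1 m) //= [X in _ - X](bigD1 m) //=.
have -> : \prod_(j | j != m) kstep (h t.+1 j) s x j = \prod_(j | j != m) kstep (h t j) s x j.
  apply: eq_bigr => j; rewrite -val_eqE /= => jm; rewrite /kstep /h ltnS leq_eqVlt.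
  by rewrite (negPf jm).
rewrite -mulrBl; congr (_ * _); rewrite /kstep /h /= ltnn ltnSn /w -[t.+1]/(m.+1) kvertexS.
by rewrite addrC addKr.
Qed.

End KuhnCycle.

(* The antisymmetrised degree of a self-map x |-> x + G x of a torus is D! times the
   number of points, whatever G is. *)
Lemma exists_nondegenerate_path (V : finZmodType) (d : nat) (e : 'I_d.+1 -> V)
    (G : V -> 'rV[int]_d.+1) :
  exists x (s : 'S_d.+1), \det (\matrix_(j, i) ((s j == i)%:R + (G (kvertex e s x j.+1) 0 i
                                     - G (kvertex e s x j) 0 i))) != 0.
Proof.
suff /existsP[x /existsP[s sN0]] : [exists x, exists s : 'S_d.+1,
    \det (\matrix_(j, i) ((s j == i)%:R + (G (kvertex e s x j.+1) 0 i
                          - G (kvertex e s x j) 0 i))) != 0] by exists x, s.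
apply: contraT; rewrite negb_exists => /forallP det0.
(* The permutation [t] prescribes which coordinate of the map is measured by each factor. The
   constant parts form the matrix of [t], whose determinant cancels the sign of [t]. *)
pose c (t : 'S_d.+1) j i : int := (t j == i)%:R.
pose w (t : 'S_d.+1) (j : 'I_d.+1) x i := c t j i + (G (x + e i) 0 (t j) - G x 0 (t j)).
have kE (t : 'S_d.+1) : (-1) ^+ t * kint (fun x s => \prod_j kstep e (w t j) s x j) = #|V|%:R.
  rewrite (kint_cohomologous e (c t) (fun j x => G x 0 (t j))).
  have -> : \matrix_(i, j) c t i j = perm_mx t.
    by apply/matrixP => i j; rewrite !mxE.
  by rewrite det_perm mulrCA -signr_addb addbb mulr1.
(* With the sum over [t] innermost, this is a signed sum of Leibniz expansions of the determinants,
   all assumed to vanish. *)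
have : \sum_(t : 'S_d.+1) (-1) ^+ t * kint (fun x s => \prod_j kstep e (w t j) s x j) = 0.
  rewrite /kint; under eq_bigr => t _ do rewrite mulr_sumr.
  rewrite exchange_big big1 //= => x _.
  under eq_bigr => t _ do rewrite mulr_sumr.
  rewrite exchange_big big1 //= => s _.
  have := det0 x; rewrite negb_exists => /forallP /(_ s); rewrite negbK => /eqP det0s.
  under eq_bigr => t _ do rewrite mulrCA.
  rewrite -mulr_sumr (_ : \sum_t _ = 0) ?mulr0 // -[RHS]det0s.
  apply: eq_bigr => t _; congr (_ * _); apply: eq_bigr => j _.
  by rewrite mxE /kstep /w /c -kvertexS eq_sym.
under eq_bigr => t _ do rewrite kE.
rewrite sumr_const -mulrnA => /eqP; rewrite pnatr_eq0 muln_eq0.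
by case/orP => /eqP /card0_eq => [/(_ 0)|/(_ 1%g)]; rewrite inE.
Qed.

Lemma mulmx_det_eq0 (n : nat) (u : 'rV[int]_n) (A : 'M[int]_n) :
  \det A != 0 -> u *m A = 0 -> u = 0.
Proof.
move=> A0 uA; apply/rowP => j; rewrite mxE.
have := congr1 (fun B => (B *m \adj A) 0 j) uA.
rewrite mul0mx -mulmxA mul_mx_adj mul_mx_scalar !mxE => /eqP.
by rewrite mulf_eq0 (negPf A0) => /eqP.
Qed.

(** The integral counterpart of [kvertex s 0 a] for the standard unit vectors. *)
Definition kcorner d (s : 'S_d.+1) (a : nat) : 'rV[int]_d.+1 :=
  \row_i ((s^-1)%g i < a)%N%:R.

Lemma exists_nondegenerate_simplex (V : finZmodType) (d : nat) (e : 'I_d.+1 -> V)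
    (G : V -> 'rV[int]_d.+1) :
  exists x s, forall a b, (a < b <= d.+1)%N ->
    kcorner s a + G (kvertex e s x a) != kcorner s b + G (kvertex e s x b).
Proof.
have [x [s detN0]] := exists_nondegenerate_path e G; exists x, s => a b /andP[ab bd].
apply: contra detN0 => /eqP Eab; apply: contraT => detN0.
(* If two vertices had the same image, rows [a] to [b - 1] of the nonsingular matrix would add up to
   zero by telescoping. *)
pose u : 'rV[int]_d.+1 := \row_j (a <= j < b)%N%:R.
have u0 : u = 0.
  apply: mulmx_det_eq0 detN0 _; apply/rowP => i; rewrite !mxE.
  pose f t : int := kcorner s t 0 i + G (kvertex e s x t) 0 i.
  have fab : f a = f b by have := congr1 (fun B : 'rV_ _ => B 0 i) Eab; rewrite !mxE /f !mxE.
  transitivity (\sum_(a <= j < b) (f j.+1 - f j)); last first.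
    by rewrite telescope_sumr ?fab ?subrr // ltnW.
  rewrite big_geq_mkord.
  rewrite (big_ord_widen_cond d.+1 (fun j => a <= j)%N (fun j => f j.+1 - f j)) //.
  rewrite [RHS]big_mkcond; apply: eq_bigr => j _; rewrite !mxE.
  case: ifP => _; last by rewrite mul0r.
  rewrite mul1r /f !mxE ltnS leq_eqVlt.
  have -> : (s j == i) = ((s^-1)%g i == j).
    by apply/eqP/eqP => [<-|<-]; rewrite ?permK ?permKV.
  rewrite -val_eqE; case: eqP => [->|_]; rewrite ?ltnn /=; ring.
have aD : (a < d.+1)%N := leq_trans ab bd.
by have := congr1 (fun B : 'rV_ _ => B 0 (Ordinal aD)) u0; rewrite !mxE leqnn ab.
Qed.

(** * Averaging and box counting against local lifts *)

Lemma agreement_card (B : finType) (b0 : B) (k : nat) (P : 'I_k -> pred B) :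
  (forall b, exists i, P i b) -> exists i, (#|B| <= k * #|[set b | P i b]%SET|)%N.
Proof.
move=> PE; suff /existsP : [exists i, #|B| <= k * #|[set b | P i b]%SET|]%N by [].
apply: contraT; rewrite negb_exists => /forallP Plt.
have cover : (#|B| <= \sum_(i < k) #|[set b | P i b]%SET|)%N.
  under eq_bigr => i _ do rewrite -sum1dep_card big_mkcond.
  rewrite exchange_big -sum1_card leq_sum // => b _.
  by have [i Pib] := PE b; rewrite (bigD1 i) //= Pib.
case: k P PE Plt cover => [|k] P PE Plt cover; first by have [[]] := PE b0.
have : (\sum_(i < k.+1) (k.+1 * #|[set b | P i b]%SET|).+1 <= \sum_(i < k.+1) #|B|)%N.
  by apply: leq_sum => i _; rewrite ltnNge.
rewrite sum_nat_const card_ord -(leq_pmul2l (ltn0Sn k)) in cover *.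
under eq_bigr => i _ do rewrite -addn1.
rewrite big_split /= sum_nat_const card_ord -big_distrr /= muln1.
by move=> /leq_trans /(_ cover); rewrite -[X in (_ <= X)%N]addn0 leq_add2l.
Qed.

Definition box (D r : nat) := {ffun 'I_D -> 'I_r}.
Definition boxvec (D r : nat) (b : box D r) : 'rV[int]_D := \row_j (b j : nat)%:Z.

Lemma boxvec_inj D r : injective (@boxvec D r).
Proof.
move=> b b' /rowP E; apply/ffunP => j; apply: val_inj.
by have := E j; rewrite !mxE => -[].
Qed.

Lemma card_box D r : #|{: box D r}| = (r ^ D)%N.
Proof. by rewrite card_ffun !card_ord. Qed.

(* The pieces attached to the d+2 vertices of a nondegenerate simplex are disjoint
   and fit in a box only slightly larger than each of them. *)
Lemma no_local_lift (V : finZmodType) (k d L : nat) (red : {additive 'rV[int]_d.+1 -> V})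
    (l : 'I_k -> V -> 'rV[int]_d.+1) :
  (k * k * L.+2 ^ d.+1 < d.+2 * L.+1 ^ d.+1)%N ->
  exists x (b : box d.+1 L.+1), forall i, l i (x + red (boxvec b)) != l i x + boxvec b.
Proof.
move=> Llarge.
suff /existsP[x /existsP[b /forallP xb]] : [exists x, exists b : box d.+1 L.+1,
    forall i, l i (x + red (boxvec b)) != l i x + boxvec b] by exists x, b.
apply: contraT => NH.
have H x (b : box d.+1 L.+1) : exists i, l i (x + red (boxvec b)) == l i x + boxvec b.
  apply/existsP; apply: contraNT NH; rewrite negb_exists => xb.
  by apply/existsP; exists x; apply/existsP; exists b.
pose good x (b : box d.+1 L.+1) i := l i (x + red (boxvec b)) == l i x + boxvec b.
have exidx x := agreement_card [ffun=> ord0] (H x).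
have [idx idxP] := fin_all_exists exidx.
have [x [s sP]] := exists_nondegenerate_simplex
  (fun i => red (delta_mx 0 i)) (fun x => - l (idx x) x).
set v := kvertex _ s x in sP.
have vE a : v a = x + red (kcorner s a).
  rewrite /v /kvertex -raddf_sum; congr (_ + red _); apply/rowP => j.
  rewrite summxE mxE; case: ltnP => ja.
    rewrite (bigD1 ((s^-1)%g j)) //= mxE permKV !eqxx big1 ?addr0 //= => i /andP[_ ij].
    by rewrite mxE /=; case: eqP => // E; rewrite E permK eqxx in ij.
  apply: big1 => i ia; rewrite mxE /=; case: eqP => // E.
  by rewrite E permK leqNgt ia in ja.
pose P := [set p : 'I_d.+2 * box d.+1 L.+1 | good (v p.1) p.2 (idx (v p.1))]%SET.
have shP (s0 : 'S_d.+1) (a : nat) (b : box d.+1 L.+1) j : (b j + ((s0^-1)%g j < a) < L.+2)%N.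
  by have := ltn_ord (b j); case: (_ < a)%N => /=; lia.
(* Corners have coordinates 0 and 1, so translating by one enlarges the side of the box only by
   1. *)
pose shift (a : nat) (b : box d.+1 L.+1) : box d.+1 L.+2 := [ffun j => Ordinal (shP s a b j)].
have shE a b : boxvec (shift a b) = kcorner s a + boxvec b.
  by apply/rowP => j; rewrite !mxE ffunE /= PoszD natz addrC.
pose f (p : 'I_d.+2 * box d.+1 L.+1) := (idx (v p.1), shift p.1 p.2).
(* Equal indices and equal shifted vectors give the same end point. As both pairs are good,
   [kcorner - l] agrees at [a] and [a'], which nondegeneracy forbids for distinct vertices. *)
have finj : {in P &, injective f}.
  move=> [a b] [a' b']; rewrite !inE /good /= => /eqP Eb /eqP Eb' [] Ei Es.
  have Ev : kcorner s a + boxvec b = kcorner s a' + boxvec b' by rewrite -!shE Es.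
  have Er : v a + red (boxvec b) = v a' + red (boxvec b').
    by rewrite !vE -!addrA -!raddfD Ev.
  have El : kcorner s a - l (idx (v a)) (v a) = kcorner s a' - l (idx (v a')) (v a').
    move: Eb; rewrite /= in Ei *; rewrite Ei Er Eb' => Eb.
    apply: (addIr (l (idx (v a')) (v a') + boxvec b')).
    by rewrite {1}Eb !addrA !addrNK.
  have aa : a = a' :> nat.
    case: (ltngtP a a') => // lt_aa.
      by have := sP a a'; rewrite lt_aa -ltnS ltn_ord El eqxx => /(_ isT).
    by have := sP a' a; rewrite lt_aa -ltnS ltn_ord El eqxx => /(_ isT).
  have {}aa : a = a' by apply: val_inj.
  by rewrite aa in Ev *; rewrite (boxvec_inj (addrI _ Ev)).
have Pub : (#|P| <= k * L.+2 ^ d.+1)%N.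
  by rewrite -(card_in_imset finj) (leq_trans (max_card _)) // card_prod card_ord card_box.
have Plb : (d.+2 * L.+1 ^ d.+1 <= k * #|P|)%N.
  have -> : #|P| = (\sum_(a < d.+2) #|[set b | good (v a) b (idx (v a))]%SET|)%N.
    under eq_bigr => a _ do rewrite -sum1dep_card.
    by rewrite pair_big_dep /= sum1dep_card.
  rewrite big_distrr /= -[X in (X * _)%N]card_ord -sum_nat_const leq_sum // => a _.
  by rewrite -card_box idxP.
have : (d.+2 * L.+1 ^ d.+1 <= k * (k * L.+2 ^ d.+1))%N.
  by rewrite (leq_trans Plb) // leq_mul2l Pub orbT.
by rewrite mulnA leqNgt Llarge.
Qed.

(** * Potentials on acyclic graphs *)

Section ForestPotential.
Variables (X : choiceType) (adj : rel X) (M : zmodType) (delta : X -> X -> M).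
Hypothesis adj_sym : symmetric adj.
Hypothesis adj_irr : irreflexive adj.
Hypothesis adj_acyclic : forall c : seq X, (2 < size c)%N -> ~ ucycle adj c.
Hypothesis deltaN : forall x y, adj x y -> delta y x = - delta x y.

Let wsum x s : M := \sum_(z <- pairmap delta x s) z.

Let wsum_cat x s1 s2 : wsum x (s1 ++ s2) = wsum x s1 + wsum (last x s1) s2.
Proof. by rewrite /wsum pairmap_cat big_cat. Qed.

Let wsum_cons x y s : wsum x (y :: s) = delta x y + wsum y s.
Proof. by rewrite /wsum /= big_cons. Qed.

Let wsum1 x y : wsum x [:: y] = delta x y.
Proof. by rewrite /wsum /= big_seq1. Qed.

Let repeated_split (s : seq X) : ~~ uniq s ->
  exists z s1 s2 s3, s = s1 ++ z :: s2 ++ z :: s3.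
Proof.
elim: s => //= y s IH; case: (boolP (y \in s)) => [ys _|_ /IH].
  by case/splitPr: ys => s2 s3; exists y, [::], s2, s3.
by case=> z [s1 [s2 [s3 ->]]]; exists z, (y :: s1), s2, s3.
Qed.

(* A shortest closed walk with a nonzero sum would be a cycle. *)
Let wsum_closed x s : path adj x s -> last x s = x -> wsum x s = 0.
Proof.
have [n] := ubnP (size s); elim: n => // n IH in x s *; rewrite ltnS => sn sP sx.
have [s_small|s_large] := leqP (size s) 2.
  case: s s_small sP sx {sn} => [|y [|z [|]]] //= _; first by rewrite /wsum /= big_nil.
    by rewrite andbT => xy yx; rewrite yx adj_irr in xy.
  by move=> /and3P[xy _ _] ->; rewrite wsum_cons wsum1 (deltaN xy) addrN.
have /repeated_split[z [s1 [s2 [s3 sE]]]] : ~~ uniq s.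
  apply/negP => us; apply: (adj_acyclic s_large); rewrite /ucycle us andbT.
  case: s sP sx {us sn s_large} => //= y p /andP[xy yp] px.
  by rewrite rcons_path yp px.
rewrite {}sE in sn sP sx *.
have ltn1 : (size (s1 ++ z :: s3) < n)%N.
  by apply: leq_trans sn; rewrite !size_cat /= !size_cat /=; lia.
have ltn2 : (size (rcons s2 z) < n)%N.
  by apply: leq_trans sn; rewrite size_rcons !size_cat /= !size_cat /=; lia.
move: sP sx; rewrite cat_path /= cat_path /= !last_cat /= last_cat /=.
case/and5P => p1 sz p2 lz p3 lx.
have E1 : wsum x (s1 ++ z :: s3) = 0.
  by apply: IH => //; rewrite ?cat_path /= ?p1 ?sz // last_cat.
have E2 : wsum z (rcons s2 z) = 0.
  by apply: IH => //; rewrite ?rcons_path ?p2 // last_rcons.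
rewrite -E1 !wsum_cat !wsum_cons -cat_rcons wsum_cat E2 add0r.
by rewrite last_rcons.
Qed.

Let reverse_walk x s : path adj x s ->
  exists2 s', path adj (last x s) s' &
    last (last x s) s' = x /\ wsum (last x s) s' = - wsum x s.
Proof.
elim: s x => [|y s IH] x /=; first by exists [::]; rewrite // /wsum /= big_nil oppr0.
case/andP => xy /IH[s' s'P [s'y s'E]]; exists (rcons s' x).
  by rewrite rcons_path s'P s'y adj_sym.
by rewrite last_rcons -cats1 wsum_cat wsum1 s'y s'E wsum_cons opprD addrC (deltaN xy).
Qed.

(** The value at [x] is the sum along a chosen walk from [r]. The walk to [x], the edge to [y] and
    the reversed walk to [y] close up, and closed walks have sum zero. *)
Lemma forest_potential (r : X) :
  (forall x, exists2 s, path adj r s & last r s = x) ->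
  exists l : X -> M, forall x y, adj x y -> l y = l x + delta x y.
Proof.
move=> conn; have walk x : exists s, path adj r s && (last r s == x).
  by have [s sP sx] := conn x; exists s; rewrite sP sx eqxx.
pose w x := xchoose (walk x).
have wP x : path adj r (w x) /\ last r (w x) = x.
  by have /andP[? /eqP] := xchooseP (walk x).
exists (fun x => wsum r (w x)) => x y xy.
have [wxP wxl] := wP x; have [wyP wyl] := wP y.
have [s' s'P [s'r s'E]] := reverse_walk wyP; rewrite wyl in s'P s'r s'E.
have : wsum r (w x ++ y :: s') = 0.
  by apply: wsum_closed; rewrite ?last_cat // cat_path wxP wxl /= xy.
rewrite wsum_cat wxl wsum_cons s'E addrA => /eqP.
by rewrite subr_eq0 => /eqP.
Qed.

End ForestPotential.

(** * Tree distances and walks *)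

Section TreeDistance.
Variables (R : realType) (X : choiceType) (T : wtree R X).

Lemma walk_weight_ge0 x s : path (tadj T) x s -> 0 <= walk_weight T x s.
Proof.
rewrite /walk_weight; elim: s x => [|y s IH] x /=; first by rewrite big_nil.
by case/andP => xy /IH ys; rewrite big_cons addr_ge0 // twt_ge0.
Qed.

Lemma walk_weight_rcons x s y :
  walk_weight T x (rcons s y) = walk_weight T x s + twt T (last x s) y.
Proof. by rewrite /walk_weight -cats1 pairmap_cat big_cat /= big_seq1. Qed.

Lemma tree_dist_le_walk x s :
  path (tadj T) x s -> tree_dist T x (last x s) <= walk_weight T x s.
Proof.
move=> sP; apply: ge_inf; last by exists s.
by exists 0 => _ [s' /= [s'P _] <-]; apply: walk_weight_ge0.
Qed.

(** The strict bound yields a walk without any claim that the infimum is attained. *)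
Lemma tree_dist_lt_walk x y b : tree_dist T x y < b ->
  exists s, [/\ path (tadj T) x s, last x s = y & walk_weight T x s < b].
Proof.
move=> /inf_lt; case.
  have [s sP sy] := tadj_connected T x y.
  by exists (walk_weight T x s), s.
by move=> _ [s /= [sP sy] <-] sb; exists s.
Qed.

End TreeDistance.

(** * The discrete torus and its Chebyshev norm *)

Definition vnorm (D : nat) (w : 'rV[int]_D) : nat := \max_j absz (w 0%R j).

Lemma vnorm_le D (w : 'rV[int]_D) m :
  (vnorm w <= m)%N = [forall j, (absz (w 0%R j) <= m)%N].
Proof. by apply/bigmax_leqP/forallP => H j; [apply: H|move=> _; apply: H]. Qed.

Lemma vnorm_coord D (w : 'rV[int]_D) j : (absz (w 0%R j) <= vnorm w)%N.
Proof. by have := leqnn (vnorm w); rewrite {1}vnorm_le => /forallP. Qed.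

Lemma vnormD D (u v : 'rV[int]_D) : (vnorm (u + v) <= vnorm u + vnorm v)%N.
Proof.
rewrite vnorm_le; apply/forallP => j; rewrite mxE.
have := vnorm_coord u j; have := vnorm_coord v j.
by move: (u 0 j) (v 0 j) => a b; lia.
Qed.

Lemma vnormN D (u : 'rV[int]_D) : vnorm (- u) = vnorm u.
Proof. by apply: eq_bigr => j _; rewrite mxE abszN. Qed.

Section Torus.
Variables (N D : nat).
Hypothesis N1 : (1 < N)%N.
Notation torus := 'rV['Z_N]_D.

Lemma intr_Zp_eq0 (z : int) : z%:~R = 0 :> 'Z_N -> exists q, z = q * N%:Z.
Proof.
move=> z0; have : `|z|%N%:R = 0 :> 'Z_N.
  by case: z z0 => n // /eqP; rewrite NegzE mulrNz oppr_eq0 => /eqP.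
move/(congr1 val); rewrite /= val_Zp_nat // => /eqP zN.
exists (z %/ N%:Z)%Z; apply/esym/divzK; exact: zN.
Qed.

(** The representative in the interval from [-N/2] (excluded) to [N/2] (included), of least absolute
    value in its class. *)
Definition zlift (a : 'Z_N) : int :=
  if ((a : nat).*2 <= N)%N then (a : nat)%:Z else (a : nat)%:Z - N%:Z.

Lemma zliftK a : (zlift a)%:~R = a.
Proof.
have aE : (a : nat)%:R = a by rewrite Zp_nat; apply: valZpK.
by rewrite /zlift; case: ifP => _; rewrite ?rmorphB /= -?pmulrn aE ?pchar_Zp ?subr0.
Qed.

Lemma zlift_bound a : (`|zlift a|.*2 <= N)%N.
Proof.
have : (a < N)%N by rewrite -{2}(Zp_cast N1) ltn_ord.
by rewrite /zlift; case: ifP; lia.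
Qed.

Lemma zlift_min (z : int) : (`|zlift z%:~R| <= `|z|)%N.
Proof.
have /intr_Zp_eq0[q qE] : (z - zlift z%:~R)%:~R = 0 :> 'Z_N.
  by rewrite rmorphB /= zliftK subrr.
have := zlift_bound z%:~R; move: (zlift _) qE => u uE ub.
have -> : z = u + q * N%:Z by rewrite -uE; ring.
case: q uE => [[|n]|n] _; nia.
Qed.

(** The two integers are congruent modulo [N], and their difference is too small to be a nonzero
    multiple of [N]. *)
Lemma zlift_uniq (z : int) : (`|z| + `|zlift z%:~R| < N)%N -> zlift z%:~R = z.
Proof.
have /intr_Zp_eq0[q qE] : (z - zlift z%:~R)%:~R = 0 :> 'Z_N.
  by rewrite rmorphB /= zliftK subrr.
move: (zlift _) qE => u uE ub.
have q0 : q = 0 by case: q uE => [[|n]|n] uE //; nia.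
by move: uE; rewrite q0 mul0r => /eqP; rewrite subr_eq0 => /eqP.
Qed.

Definition tred (w : 'rV[int]_D) : torus := map_mx intr w.

Lemma tred_is_additive : zmod_morphism tred.
Proof. by move=> u v; apply/rowP => j; rewrite !mxE rmorphB. Qed.
HB.instance Definition _ := GRing.isZmodMorphism.Build _ _ tred tred_is_additive.

Definition tlift (a : torus) : 'rV[int]_D := map_mx zlift a.

Lemma tliftK a : tred (tlift a) = a.
Proof. by apply/rowP => j; rewrite !mxE zliftK. Qed.

Lemma tlift0 : tlift 0 = 0.
Proof. by apply/rowP => j; rewrite !mxE. Qed.

Definition tnorm (a : torus) : nat := vnorm (tlift a).

Lemma tnorm0 : tnorm 0 = 0%N.
Proof. by rewrite /tnorm tlift0; apply: big1 => j _; rewrite mxE. Qed.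

Lemma tnorm_min w : (tnorm (tred w) <= vnorm w)%N.
Proof.
rewrite {1}/tnorm vnorm_le; apply/forallP => j; rewrite !mxE.
apply: leq_trans (zlift_min _) _.
exact: vnorm_coord.
Qed.

Lemma tlift_uniq w a : tred w = a -> (vnorm w + tnorm a < N)%N -> tlift a = w.
Proof.
move=> <- wN; apply/rowP => j; rewrite !mxE; apply: zlift_uniq.
apply: leq_ltn_trans wN; apply: leq_add; first exact: vnorm_coord.
by have := vnorm_coord (tlift (tred w)) j; rewrite !mxE.
Qed.

Lemma tnormD a b : (tnorm (a + b) <= tnorm a + tnorm b)%N.
Proof.
rewrite -{1}(tliftK a) -{1}(tliftK b) -raddfD.
exact: leq_trans (tnorm_min _) (vnormD _ _).
Qed.

Lemma tnormN a : tnorm (- a) = tnorm a.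
Proof.
have le b : (tnorm (- b) <= tnorm b)%N.
  by rewrite -{1}(tliftK b) -raddfN (leq_trans (tnorm_min _)) // vnormN.
by apply/eqP; rewrite eqn_leq le -{1}(opprK a) le.
Qed.

End Torus.

(** * The hard metric space and the distortion of its tree covers *)

Section RetractMetric.
Variables (R : realType) (N D n : nat) (N1 : (1 < N)%N) (f : 'I_n -> 'rV['Z_N]_D).

(* Points with the same image are put at distance 1, so that [f] is 1-Lipschitz
   and the metric has as many points as wanted. *)
Definition rdist (i j : 'I_n) : nat :=
  if i == j then 0%N else maxn 1 (tnorm (f j - f i)).

Lemma rdist_triangle j i k : (rdist i k <= rdist i j + rdist j k)%N.
Proof.
rewrite /rdist; case: (eqVneq i k) => // ik.
case: (eqVneq i j) => [<-|ij]; first by rewrite add0n (negPf ik).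
case: (eqVneq j k) => [<-|jk]; first by rewrite addn0.
have := tnormD N1 (f k - f j) (f j - f i); rewrite addrA addrNK.
by move: (tnorm _) (tnorm _) (tnorm _) => a b c; lia.
Qed.

Lemma rdist_sym i j : rdist i j = rdist j i.
Proof. by rewrite /rdist eq_sym -opprB tnormN. Qed.

(* The unused binding makes the carrier remember the data that define its metric. *)
Definition retract_space : Type := let _ := (R, N1, f) in 'I_n.

HB.instance Definition _ := Choice.on retract_space.

Let dist (x y : retract_space) : R := (rdist x y)%:R.

Let distxx x : dist x x = 0.
Proof. by rewrite /dist /rdist eqxx. Qed.

Let dist_pos x y : dist x y = 0 -> x = y.
Proof.
move/eqP; rewrite /dist pnatr_eq0 /rdist; case: (eqVneq x y) => // _.
by rewrite -leqn0 geq_max.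
Qed.

Let dist_sym x y : dist x y = dist y x.
Proof. by rewrite /dist rdist_sym. Qed.

Let dist_triangle y x z : dist x z <= dist x y + dist y z.
Proof. by rewrite /dist -natrD ler_nat rdist_triangle. Qed.

HB.instance Definition _ := @isMetric.Build R retract_space dist
  distxx dist_pos dist_sym dist_triangle.

Lemma mdist_retract (x y : retract_space) : mdist x y = (rdist x y)%:R.
Proof. by []. Qed.

End RetractMetric.

(* Tree edges longer than a quarter of the torus get displacement 0; they never occur
   on a walk of weight less than [b]. *)
Lemma tree_lift (R : realType) (N D n : nat) (N1 : (1 < N)%N) (f : 'I_n -> 'rV['Z_N]_D)
    (T : wtree R (retract_space R N1 f)) (r : 'I_n) (b : R) :
  (forall x y : retract_space R N1 f, mdist x y <= tree_dist T x y) ->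
  4 * b <= N%:R ->
  exists l : 'I_n -> 'rV[int]_D, forall x y,
    tree_dist T x y < b -> l y = l x + tlift (f y - f x).
Proof.
move=> dom bN; pose tn x y := tnorm (f y - f x).
pose delta (x y : 'I_n) := if (4 * tn x y < N)%N then tlift (f y - f x) else 0.
have tnC x y : tn x y = tn y x by rewrite /tn -opprB tnormN.
have tn_lt x y : mdist (x : retract_space R N1 f) y < b -> (4 * tn x y < N)%N.
  rewrite mdist_retract => xyc; rewrite -(ltr_nat R) natrM.
  have le_tn : (tn x y)%:R <= (rdist f x y)%:R :> R.
    rewrite ler_nat /rdist; case: eqP => [->|_]; last by rewrite leq_maxr.
    by rewrite /tn subrr tnorm0.
  lra.
have [l lE] : exists l : 'I_n -> 'rV[int]_D, forall x y, tadj T x y -> l y = l x + delta x y.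
  apply: (forest_potential (@tadj_sym _ _ T) (@tadj_irr _ _ T) (@tadj_acyclic _ _ T) _ (r := r)).
    (* A coordinate [N/2] would break the antisymmetry of the lift; below the threshold, uniqueness
       of short lifts gives it. *)
    move=> x y _; rewrite /delta (tnC y x); case: ifP => tl; last by rewrite oppr0.
    apply: tlift_uniq => //; first by rewrite raddfN /= tliftK // opprB.
    by rewrite vnormN -/(tnorm _) -/(tn x y) -/(tn y x) (tnC y x); lia.
  exact: tadj_connected.
exists l => x y /tree_dist_lt_walk[s [sP <- sb]].
(* Every prefix of the walk also weighs less than [b], so domination keeps its end within [b] of
   [x]. *)
elim/last_ind: s sP sb {y} => [|s y IH] /=.
  by move=> _ _; rewrite subrr tlift0 addr0.
rewrite rcons_path last_rcons walk_weight_rcons => /andP[sP uy] sb.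
have sub_path : path (tadj T) x (rcons s y) by rewrite rcons_path sP.
have s0 := walk_weight_ge0 sP; have uy0 := twt_ge0 uy.
have dxy : mdist (x : retract_space R N1 f) y < b.
  apply: le_lt_trans sb; rewrite -walk_weight_rcons -{1}(last_rcons x s y).
  exact: le_trans (dom _ _) (tree_dist_le_walk sub_path).
have dxu : mdist (x : retract_space R N1 f) (last x s) < b.
  apply: (@le_lt_trans _ _ (walk_weight T x s)); last lra.
  exact: le_trans (dom _ _) (tree_dist_le_walk sP).
have duy : mdist (last x s : retract_space R N1 f) y < b.
  apply: (@le_lt_trans _ _ (twt T (last x s) y)); last lra.
  have uyP : path (tadj T) (last x s) [:: y] by rewrite /= uy.
  apply: le_trans (dom _ _) _; apply: le_trans (tree_dist_le_walk uyP) _.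
  by rewrite /walk_weight /= big_seq1.
rewrite (lE _ _ uy) IH //; last lra.
have t1 := tn_lt _ _ dxy; have t2 := tn_lt _ _ dxu.
have t3 := tn_lt _ _ duy.
(* All three displacements have norm below [N/4], so the sum of two lifts is the unique short lift
   of the total displacement. *)
rewrite /delta t3 -addrA; congr (_ + _); apply/esym; apply: tlift_uniq => //.
  by rewrite raddfD /= !tliftK // addrC addrA addrNK.
have := vnormD (tlift (f (last x s) - f x)) (tlift (f y - f (last x s))).
move: t1 t2 t3; rewrite /tn /tnorm.
by move: (vnorm _) (vnorm _) (vnorm _) (vnorm _) => a1 a2 a3 a4; clear; lia.
Qed.

(** Points whose torus images differ by a box vector are within [L], so a smaller [alpha] would put
    some tree distance between [g x] and [g (x + o)] below [N/4]. The maps of [tree_lift] would then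
    violate [no_local_lift]. *)
Lemma cover_distortion_ge (R : realType) (N d k n L : nat) (N1 : (1 < N)%N)
    (f : 'I_n -> 'rV['Z_N]_d.+1) (g : 'rV['Z_N]_d.+1 -> 'I_n) (alpha : R)
    (T : 'I_k -> wtree R (retract_space R N1 f)) :
  (k * k * L.+2 ^ d.+1 < d.+2 * L.+1 ^ d.+1)%N -> cancel g f ->
  (0 < L)%N -> (2 * L < N)%N -> is_tree_cover alpha T -> N%:R / (8 * L%:R) <= alpha.
Proof.
move=> Llarge gK L0 LN [dom cover].
have L0' : 0 < L%:R :> R by rewrite ltr0n.
have N0' : 0 < N%:R :> R by rewrite ltr0n ltnW.
rewrite leNgt; apply/negP => alpha_lt.
have alphaL : alpha * L%:R < N%:R / 4.
  have : alpha * (8 * L%:R) < N%:R by rewrite -ltr_pdivlMr // mulr_gt0.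
  lra.
have quarter : 4 * (N%:R / 4) <= N%:R :> R by lra.
have [l lP] := fin_all_exists (fun i => tree_lift (g 0) (dom i) quarter).
have [x [b xb]] := @no_local_lift _ k d L (@tred N d.+1) (fun i v => l i (g v)) Llarge.
have [i] := cover (g x) (g (x + tred N (boxvec b))).
apply/negP; rewrite -ltNge.
have bL : (vnorm (boxvec b) <= L)%N.
  by rewrite vnorm_le; apply/forallP => j; rewrite mxE absz_nat -ltnS ltn_ord.
have rL : (rdist f (g x) (g (x + tred N (boxvec b))%R) <= L)%N.
  rewrite /rdist; case: eqP => // _; rewrite geq_max L0 !gK addrC addKr.
  exact: leq_trans (tnorm_min N1 _) bL.
have tL : tlift (tred N (boxvec b)) = boxvec b.
  by apply: tlift_uniq => //; have := tnorm_min N1 (boxvec b); lia.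
rewrite mdist_retract ltNge; apply/negP => small.
have := xb i; rewrite (lP i (g x)) ?gK; first by rewrite [_ - x]addrC addKr tL eqxx.
apply: le_lt_trans small _.
have [a0|a0] := lerP 0 alpha; last first.
  apply: (@le_lt_trans _ _ 0); last by rewrite divr_gt0.
  by rewrite mulr_le0_ge0 // ltW.
by apply: le_lt_trans alphaL; rewrite ler_wpM2l // ler_nat.
Qed.

(** * Choice of parameters and the lower bound *)

Lemma box_growth (m j : nat) : (j <= m)%N -> (m.+1 ^ j * (m - j) <= m ^ j.+1)%N.
Proof.
elim: j => [|j IH] jm; first by rewrite expn0 mul1n subn0 expn1.
rewrite [(m ^ _.+2)%N]expnS; apply: leq_trans (leq_mul (leqnn m) (IH (ltnW jm))).
rewrite expnS; move: (m.+1 ^ j)%N => e.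
have H : (m.+1 * (m - j.+1) <= m * (m - j))%N by nia.
by rewrite [(m.+1 * e)%N]mulnC -mulnA [X in (_ <= X)%N]mulnCA leq_mul2l H orbT.
Qed.

(** The ratio of [L.+2 ^ D] to [L.+1 ^ D] tends to 1 as [L] grows; [box_growth], Bernoulli's
    inequality with denominators cleared, makes this explicit. *)
Lemma exists_box_size (D : nat) :
  exists2 L, (0 < L)%N & (D * L.+2 ^ D < D.+1 * L.+1 ^ D)%N.
Proof.
case: D => [|D]; first by exists 1%N.
(* Here [m] is [L.+1]. It is chosen so that [E * m] falls short of [E.+1 * (E * E + 1)] by exactly
   1. *)
exists (D.+1 * D.+2)%N => //; move: D.+1 => E; set m := (E * E.+1).+1.
have Em : (E <= m)%N by rewrite /m; nia.
have mE : (m - E = E * E + 1)%N by rewrite /m; nia.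
have := box_growth Em; rewrite expnS mE.
have : (0 < m ^ E)%N by rewrite expn_gt0.
move: (m.+1 ^ E)%N (m ^ E)%N => A B B0 AB.
rewrite -(@ltn_pmul2r (E * E + 1)%N); last lia.
apply: (@leq_ltn_trans (E * (m * B))); first by rewrite -mulnA leq_mul.
by rewrite /m; nia.
Qed.

Lemma root_power (R : realType) (n M D : nat) (e : R) :
  (0 < D)%N -> (0 < n)%N -> (n <= M ^ D)%N -> e <= D%:R^-1 -> n%:R `^ e <= M%:R :> R.
Proof.
move=> D0 n0 nM eD; have n1 : 1 <= n%:R :> R by rewrite ler1n.
apply: (le_trans (ler_powR n1 eD)).
have -> : M%:R = (M ^ D)%N%:R `^ D%:R^-1 :> R.
  by rewrite natrX -powR_mulrn ?ler0n // -powRrM divff ?powRr1 ?ler0n // pnatr_eq0 -lt0n.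
by rewrite ge0_ler_powR ?invr_ge0 ?ler0n ?nnegrE ?ler0n ?ler_nat.
Qed.

Lemma exists_retraction (N D n : nat) : (1 < N)%N -> (N ^ D <= n)%N ->
  exists (f : 'I_n -> 'rV['Z_N]_D) (g : 'rV['Z_N]_D -> 'I_n), cancel g f.
Proof.
move=> N1 Nn; have cV : (#|{: 'rV['Z_N]_D}| <= n)%N.
  by rewrite card_mx mul1n card_ord Zp_cast.
(* Indices past the end of the enumeration go to the default point 0. *)
pose f (i : 'I_n) : 'rV['Z_N]_D := nth 0 (enum {: 'rV['Z_N]_D}) i.
by exists f, (fun v => widen_ord cV (enum_rank v)) => v; rewrite /f /= nth_enum_rank.
Qed.

Theorem theorem1p1 (R : realType) (k p : nat) (hk : (8 <= k)%N)
    (hp : prime p) (hkp : (k < p)%N)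
    (hpmin : forall q : nat, prime q -> (k < q)%N -> (p <= q)%N) :
  exists (c : R) (n0 : nat), 0 < c /\
    forall n : nat, (n0 <= n)%N ->
      exists X : metricType R, [set: X] #= `I_n /\
        forall (alpha : R) (T : 'I_k -> wtree R X),
          is_tree_cover alpha T ->
          c * n%:R `^ ((k * (p - 1))%:R^-1) <= alpha.
Proof.
(* Dimension [k * k] makes the number [d.+2] of simplex vertices exceed [k * k], as the counting
   requires. *)
have [d dE] : exists d, d.+1 = (k * k)%N by exists (k * k).-1; rewrite prednK // muln_gt0; lia.
have [L L0 Llarge] := exists_box_size (k * k).
have L0' : 0 < L%:R :> R by rewrite ltr0n.
(* The threshold for [n] forces the side of the torus above [2 * L]. The 16 is twice the 8 of
   [cover_distortion_ge], to absorb [N.+1 <= 2 * N]. *)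
exists (16 * L%:R)^-1, ((2 * L).+1 ^ d.+1)%N; split.
  by rewrite invr_gt0 mulr_gt0.
move=> n n_ge.
have exN : exists N, (N ^ d.+1 <= n)%N by exists (2 * L).+1.
have leN N : (N ^ d.+1 <= n)%N -> (N <= n)%N.
  by apply: leq_trans; case: N => // N; rewrite expnS leq_pmulr // expn_gt0.
(* Maximality of [N] gives [n < N.+1 ^ d.+1], which bounds the root of [n] by [N.+1]. *)
case: (ex_maxnP exN leN) => N Nn Nmax.
have LN : (2 * L < N)%N by apply: Nmax.
have N1 : (1 < N)%N by lia.
have [f [g gK]] := exists_retraction N1 Nn.
exists (retract_space R N1 f); split.
  by rewrite card_eq_sym; exact: (@card_II n).
move=> alpha T /(cover_distortion_ge _ gK L0 LN) alpha_ge.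
have {}alpha_ge : N%:R / (8 * L%:R) <= alpha by apply: alpha_ge; rewrite dE.
apply: le_trans alpha_ge; rewrite mulrC ler_pdivrMr ?mulr_gt0 //.
have -> : N%:R / (8 * L%:R) * (16 * L%:R) = 2 * N%:R :> R.
  by field; rewrite gt_eqF.
apply: (@le_trans _ _ (N.+1)%:R); last first.
  by rewrite -natrM ler_nat; lia.
apply: (@root_power _ _ _ d.+1) => //.
- by apply: leq_trans n_ge; rewrite expn_gt0.
- by rewrite leqNgt; apply/negP => /ltnW /Nmax; rewrite ltnn.
(* Since [k < p], the dimension [k * k] is at most [k * (p - 1)]. *)
rewrite lef_pV2 ?posrE ?ltr0n ?ler_nat ?muln_gt0 ?dE ?leq_mul2l; lia.
Qed.
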